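(* Let $k,m\ge 1$ and $n\ge 0$ be integers. The number of $(k,m)$-ary trees of order $n$ equals $$C_{k,m}(n):=\frac{1}{mn+1}\binom{(mn+1)k}{n}.$$
   Context: All trees are unlabelled plane trees: rooted trees whose vertices are indistinguishable but in which the children of each vertex are linearly ordered. The degree of a vertex is its number of children. A vertex is on level $j$ if its distance to the root is $j$ (the root is on level $0$). For $k,m\ge 1$ and $n\ge 0$, a $(k,m)$-ary tree of order $n$ is a plane tree such that (1) every vertex on an even level has degree exactly $k$, and (2) every vertex on an odd level has degree $m$ or $0$, and exactly $n$ vertices (necessarily on odd levels) have degree $m$. *)

(* Defs.v *)
From HB Require Import structures.
From mathcomp Require Import all_boot all_order all_algebra.

Set Implicit Arguments.
Unset Strict Implicit.
Unset Printing Implicit Defensive.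

Import GRing.Theory.

Inductive plane_tree := Node of seq plane_tree.

Fixpoint plane_tree_nested_ind (P : plane_tree -> Prop)
    (IH : forall ts, foldr (fun t Q => P t /\ Q) True ts -> P (Node ts))
    (t : plane_tree) {struct t} : P t :=
  let: Node ts := t in
  IH ts ((fix aux (s : seq plane_tree) :
            foldr (fun t Q => P t /\ Q) True s :=
            if s is t' :: s' then conj (plane_tree_nested_ind IH t') (aux s')
            else I) ts).

Fixpoint plane_tree_encode (t : plane_tree) : GenTree.tree void :=
  let: Node ts := t in GenTree.Node 0 (map plane_tree_encode ts).

Fixpoint plane_tree_decode (t : GenTree.tree void) : plane_tree :=
  match t with
  | GenTree.Leaf _ => Node [::]
  | GenTree.Node _ ts => Node (map plane_tree_decode ts)
  end.

Lemma plane_tree_encodeK : cancel plane_tree_encode plane_tree_decode.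
Proof.
elim/plane_tree_nested_ind => ts /= IH; congr Node.
by elim: ts IH => //= t ts IHts [-> /IHts ->].
Qed.

HB.instance Definition _ :=
  Countable.copy plane_tree (can_type plane_tree_encodeK).

(* The vertices of t in preorder, each recorded as the pair (level, degree),
   when the root of t is placed on level l. *)
Fixpoint vertices_from (l : nat) (t : plane_tree) : seq (nat * nat) :=
  let: Node ts := t in (l, size ts) :: flatten (map (vertices_from l.+1) ts).

Definition vertices (t : plane_tree) : seq (nat * nat) := vertices_from 0 t.

(* The order counts only the vertices of degree m on odd levels: when k = m
   the vertices on even levels also have degree m, but are not counted. *)
Definition km_ary_tree (k m n : nat) (t : plane_tree) : bool :=
  [&& all (fun v => ~~ odd v.1 ==> (v.2 == k)) (vertices t),
      all (fun v => odd v.1 ==> ((v.2 == m) || (v.2 == 0))) (vertices t)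
    & count (fun v => odd v.1 && (v.2 == m)) (vertices t) == n].

Definition C_km (k m n : nat) : rat :=
  (1 / (m * n + 1)%:R * ('C((m * n + 1) * k, n))%:R)%R.

(* Main.v *)
Require Import Defs.
From mathcomp Require Import all_boot all_order all_algebra.
From mathcomp Require Import zify ring.

(** Deleting the root of a (k, m)-ary tree leaves k plane trees rooted at level
1. In a forest of q + 1 such trees the first one is either a single vertex, or
has m children; deleting in the latter case its root and these m children
leaves a forest of m k + q such trees, of order one less. So the number b q n of
forests of q trees and order n satisfies
b (q + 1) (n + 1) = b q (n + 1) + b (q + m k) n, whose solution is the
Fuss-Catalan (Raney) number q / (q + m k n) * 'C(q + m k n, n). *)

Definition children (t : plane_tree) : seq plane_tree := let: Node ts := t in ts.

Definition forest_vertices (l : nat) (ts : seq plane_tree) : seq (nat * nat) :=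
  flatten (map (vertices_from l) ts).

Definition km_vertex (k m : nat) (v : nat * nat) : bool :=
  if odd v.1 then (v.2 == m) || (v.2 == 0) else v.2 == k.

Definition counted_vertex (m : nat) (v : nat * nat) : bool :=
  odd v.1 && (v.2 == m).

Definition km_forest (k m l : nat) (ts : seq plane_tree) : bool :=
  all (km_vertex k m) (forest_vertices l ts).

Definition forest_order (m l : nat) (ts : seq plane_tree) : nat :=
  count (counted_vertex m) (forest_vertices l ts).

Lemma Node_inj : injective Node.
Proof. by move=> ts us []. Qed.

Lemma km_ary_treeE (k m n : nat) (ts : seq plane_tree) :
  km_ary_tree k m n (Node ts) =
  [&& size ts == k, km_forest k m 1 ts & forest_order m 1 ts == n].
Proof.
rewrite /km_ary_tree andbA -all_predI /= /km_forest /forest_order add0n.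
rewrite andbT -andbA; congr [&& _, _ & _].
by apply: eq_all => v; rewrite /km_vertex /=; case: odd; rewrite ?andbT.
Qed.

Lemma vertices_fromS (l : nat) (t : plane_tree) :
  vertices_from l.+1 t = [seq (v.1.+1, v.2) | v <- vertices_from l t].
Proof.
elim/plane_tree_nested_ind: t l => ts IH l /=; congr cons.
by elim: ts IH => //= t ts IHts [IHt /IHts ->]; rewrite map_cat IHt.
Qed.

Lemma forest_verticesSS (l : nat) (ts : seq plane_tree) :
  forest_vertices l.+2 ts = [seq (v.1.+2, v.2) | v <- forest_vertices l ts].
Proof.
elim: ts => //= t ts; rewrite /forest_vertices /= map_cat => ->.
by rewrite !vertices_fromS -map_comp.
Qed.

(** [km_vertex] sees a level only through its parity. Hence what remains after deleting two levels
    can be read as rooted on the original level. *)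
Lemma km_forestSS (k m l : nat) (ts : seq plane_tree) :
  km_forest k m l.+2 ts = km_forest k m l ts.
Proof.
rewrite /km_forest forest_verticesSS all_map; apply: eq_all => v /=.
by rewrite /km_vertex /= negbK.
Qed.

Lemma forest_orderSS (m l : nat) (ts : seq plane_tree) :
  forest_order m l.+2 ts = forest_order m l ts.
Proof.
rewrite /forest_order forest_verticesSS count_map; apply: eq_count => v /=.
by rewrite /counted_vertex /= negbK.
Qed.

Lemma km_forest_cons (k m l : nat) (t : plane_tree) (ts : seq plane_tree) :
  km_forest k m l (t :: ts) =
  [&& km_vertex k m (l, size (children t)), km_forest k m l.+1 (children t)
    & km_forest k m l ts].
Proof. by case: t => us; rewrite /km_forest /forest_vertices /= all_cat andbA. Qed.

Lemma forest_order_cons (m l : nat) (t : plane_tree) (ts : seq plane_tree) :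
  forest_order m l (t :: ts) =
  counted_vertex m (l, size (children t)) + forest_order m l.+1 (children t)
  + forest_order m l ts.
Proof.
by case: t => us; rewrite /forest_order /forest_vertices /= count_cat addnA.
Qed.

Lemma km_forest_cat (k m l : nat) (ts us : seq plane_tree) :
  km_forest k m l (ts ++ us) = km_forest k m l ts && km_forest k m l us.
Proof. by rewrite /km_forest /forest_vertices map_cat flatten_cat all_cat. Qed.

Lemma forest_order_cat (m l : nat) (ts us : seq plane_tree) :
  forest_order m l (ts ++ us) = forest_order m l ts + forest_order m l us.
Proof. by rewrite /forest_order /forest_vertices map_cat flatten_cat count_cat. Qed.

(** Meant for the children of a level-1 root: their level 2 counts as 0 by parity, and their own
    children form a forest on an odd level again. *)
Lemma km_forest_even (k m : nat) (ts : seq plane_tree) :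
  km_forest k m 0 ts =
  all (fun t => size (children t) == k) ts
  && km_forest k m 1 (flatten (map children ts)).
Proof.
elim: ts => // t ts IH; rewrite km_forest_cons IH /= km_forest_cat.
rewrite {1}/km_vertex /=.
by case: eqP; case: km_forest; case: all; case: km_forest.
Qed.

Lemma forest_order_even (m : nat) (ts : seq plane_tree) :
  forest_order m 0 ts = forest_order m 1 (flatten (map children ts)).
Proof.
by elim: ts => // t ts IH; rewrite forest_order_cons IH /= forest_order_cat.
Qed.

(** Inverse of the deletion step: the first [m * k] trees are cut into [m] blocks of [k], each block
    gets a root, and these [m] roots get a common parent. With fewer than [m * k] trees some blocks
    come out short. *)
Definition graft (k m : nat) (f : seq plane_tree) : seq plane_tree :=
  Node (map Node (reshape (nseq m k) f)) :: drop (m * k) f.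

Definition ungraft (f : seq plane_tree) : seq plane_tree :=
  if f is t :: f' then flatten (map children (children t)) ++ f' else [::].

Lemma graftK (k m : nat) (f : seq plane_tree) :
  m * k <= size f -> ungraft (graft k m f) = f.
Proof.
move=> le_f; rewrite /ungraft /graft /= mapK //.
rewrite -[RHS](cat_take_drop (m * k)); congr (_ ++ _).
elim: m f le_f => [|m IH] f le_f /=; first by rewrite take0.
rewrite IH ?size_drop ?mulSn; last by rewrite mulSn in le_f; lia.
by rewrite takeD.
Qed.

Lemma ungraftK (k m : nat) (us f : seq plane_tree) :
  size us = m -> all (fun t => size (children t) == k) us ->
  graft k m (ungraft (Node us :: f)) = Node us :: f.
Proof.
move=> <-; rewrite /graft /=; elim: us => [|[u] us IH] /=; first by rewrite drop0.
case/andP=> /eqP u_k us_k; case: (IH us_k) => E1 E2.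
by rewrite -catA take_size_cat // drop_size_cat // E1 mulSn addnC -drop_drop
  drop_size_cat // E2.
Qed.

Lemma size_ungraft (k : nat) (us f : seq plane_tree) :
  all (fun t => size (children t) == k) us ->
  size (ungraft (Node us :: f)) = size us * k + size f.
Proof.
rewrite /= size_cat => us_k; congr (_ + _).
elim: us us_k => //= u us IH /andP[/eqP u_k us_k].
by rewrite size_cat mulSn u_k IH.
Qed.

(** The nested fixpoints give a lexicographic recursion: a leaf in front lowers [q] at fixed [n],
    while a graft lowers [n] but raises the number of trees. *)
Fixpoint forests (k m n : nat) : nat -> seq (seq plane_tree) :=
  fix forests_n (q : nat) :=
    if q is q'.+1 then
      map (cons (Node [::])) (forests_n q') ++
      (if n is n'.+1 then map (graft k m) (forests k m n' (m * k + q')) else [::])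
    else nseq (n == 0) [::].

Lemma forestsS (k m n q : nat) :
  forests k m n q.+1 = map (cons (Node [::])) (forests k m n q) ++
    (if n is n'.+1 then map (graft k m) (forests k m n' (m * k + q)) else [::]).
Proof. by case: n. Qed.

Lemma forests0 (k m n : nat) : forests k m n 0 = nseq (n == 0) [::].
Proof. by case: n. Qed.

Section Forests.

Variables (k m : nat) (hm : 0 < m).

Definition in_forests (n q : nat) (f : seq plane_tree) : bool :=
  [&& size f == q, km_forest k m 1 f & forest_order m 1 f == n].

Lemma in_forests_leaf (n q : nat) (f : seq plane_tree) :
  in_forests n q.+1 (Node [::] :: f) = in_forests n q f.
Proof.
rewrite /in_forests km_forest_cons forest_order_cons /= eqSS.
by rewrite /km_vertex /counted_vertex /= orbT (ltn_eqF hm).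
Qed.

Lemma in_forests_graft (n q : nat) (u : plane_tree) (us f : seq plane_tree) :
  in_forests n q.+1 (Node (u :: us) :: f) =
  [&& size (u :: us) == m, all (fun t => size (children t) == k) (u :: us), 0 < n
    & in_forests n.-1 (m * k + q) (ungraft (Node (u :: us) :: f))].
Proof.
rewrite /in_forests km_forest_cons forest_order_cons km_forestSS forest_orderSS.
(* The first root has a child, so its degree can only be [m], and it contributes one to the
   order. *)
rewrite [children _]/= {1}/km_vertex {1}/counted_vertex [odd _]/= orbF [(_, _).2]/=.
case: (size (u :: us) =P m) => [us_m|_]; last by rewrite !andFb andbF.
rewrite km_forest_even forest_order_even.
case: (boolP (all _ _)) => us_k; last by rewrite !andFb andbF.
rewrite (size_ungraft k _ f us_k) us_m eqn_add2l !andTb.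
rewrite /ungraft km_forest_cat forest_order_cat [size (_ :: _)]/= eqSS -!andbA.
by case: n => [|n]; rewrite ?andbF.
Qed.

(** The first root of a grafted forest has [m > 0] children. This keeps the two halves of [forests]
    disjoint. *)
Lemma graft_neq_leaf (g f : seq plane_tree) : graft k m g <> Node [::] :: f.
Proof. by case: m hm => // m' _ []. Qed.

Lemma mem_forests (n q : nat) (f : seq plane_tree) :
  (f \in forests k m n q) = in_forests n q f.
Proof.
elim: n q f => [|n IHn]; elim=> [|q IHq] f; rewrite ?forests0 ?forestsS.
- by case: f.
- rewrite cats0; case: f => [|[[|u us]] f].
  + by apply/negP=> /mapP[].
  + by rewrite mem_map ?IHq ?in_forests_leaf // => ? ? [].
  by rewrite in_forests_graft !andbF; apply/negP=> /mapP[].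
- by case: f.
rewrite mem_cat; case: f => [|[[|u us]] f].
- by apply/negP=> /orP[] /mapP[].
- rewrite mem_map ?IHq ?in_forests_leaf //; last by move=> ? ? [].
  by rewrite orbC; case: mapP => // -[g _ /esym/graft_neq_leaf].
rewrite in_forests_graft andTb -IHn.
have /negPf -> :
    Node (u :: us) :: f \notin map (cons (Node [::])) (forests k m n.+1 q).
  by apply/negP=> /mapP[].
rewrite orFb; apply/mapP/and3P => [[g g_in gE] | [/eqP us_m us_k g_in]]; last first.
  by exists (ungraft (Node (u :: us) :: f)); rewrite ?ungraftK.
have size_g : m * k <= size g.
  by move: g_in; rewrite IHn => /and3P[/eqP-> _ _]; apply: leq_addr.
rewrite gE graftK // g_in; case: gE => -> _; split=> //.
  by rewrite size_map size_reshape size_nseq.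
(* As [g] is long enough, every block has exactly [k] trees. *)
have shapeE : shape (reshape (nseq m k) g) = nseq m k.
  by rewrite reshapeKl // sumn_nseq mulnC.
by have := all_pred1_nseq k m; rewrite -{1}shapeE !all_map.
Qed.

Lemma uniq_forests (n q : nat) : uniq (forests k m n q).
Proof.
elim: n q => [|n IHn]; elim=> [|q IHq]; rewrite ?forests0 ?forestsS //.
  by rewrite cats0 map_inj_uniq // => ? ? [].
rewrite cat_uniq map_inj_uniq ?IHq /=; last by move=> ? ? [].
apply/andP; split.
  by apply/hasPn=> f /mapP[g _ ->]; apply/mapP=> -[h _ /graft_neq_leaf].
rewrite map_inj_in_uniq // => f g; rewrite !mem_forests.
case/and3P=> /eqP size_f _ _ /and3P[/eqP size_g _ _] /(congr1 ungraft).
by rewrite !graftK ?size_f ?size_g ?leq_addr.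
Qed.

(** The Raney number with its denominator cleared, to stay in [nat]. The induction, on [n] and then
    on [q], mirrors the recursion of [forests]. *)
Lemma size_forests (hk : 0 < k) (n q : nat) :
  size (forests k m n q) * (q + m * k * n) = q * 'C(q + m * k * n, n).
Proof.
have r_gt0 : 0 < m * k by rewrite muln_gt0 hm.
elim: n q => [|n IHn] q.
  (* Order 0 leaves only the forest of [q] single vertices. *)
  have -> : size (forests k m 0 q) = 1.
    by elim: q => [|q IHq]; rewrite ?forests0 ?forestsS ?cats0 ?size_map.
  by rewrite muln0 addn0 bin0 mul1n muln1.
elim: q => [|q IHq]; first by rewrite forests0.
rewrite forestsS size_cat !size_map addSn binS.
move: (IHn (m * k + q)) IHq.
set r := m * k in r_gt0 *.
(* Both induction hypotheses now have the same denominator, called [M] below. *)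
rewrite (_ : r + q + r * n = q + r * n.+1); last by rewrite mulnS; lia.
set x := size _; set y := size _; set M := q + r * n.+1.
have := mul_bin_left M n.
set a := 'C(M, n.+1); set b := 'C(M, n) => Eab Ey Ex.
have M_gt0 : 0 < M by rewrite addn_gt0 muln_gt0 r_gt0 orbT.
(* This makes the truncated subtraction [M - n] in [Eab] exact. *)
have le_nM : n <= M by rewrite /M; nia.
apply/eqP; rewrite -(eqn_pmul2r M_gt0); apply/eqP.
have {}Eab : n.+1 * a + n * b = M * b by nia.
rewrite (_ : (y + x) * M.+1 * M = (y * M + x * M) * M.+1); last by ring.
rewrite Ex Ey.
(* After expansion, the two sides of the goal differ by [r] times the difference of the sides of
   [Eab]. *)
have := congr1 (muln r) Eab; rewrite /M; nia.
Qed.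

End Forests.

(* The duplicate-free list s enumerates exactly the (k, m)-ary trees of
   order n, so that its size is their number. *)
Theorem theorem2p2 (k m n : nat) (hk : 1 <= k) (hm : 1 <= m) :
  exists s : seq plane_tree,
    [/\ uniq s,
        forall t : plane_tree, (t \in s) = km_ary_tree k m n t
      & ((size s)%:R = C_km k m n)%R].
Proof.
exists (map Node (forests k m n k)); split.
- by rewrite (map_inj_uniq Node_inj) uniq_forests.
- move=> [ts]; rewrite (mem_map Node_inj) mem_forests //.
  by rewrite km_ary_treeE.
have := size_forests k m hm hk n k; rewrite size_map /C_km.
(* At [q = k] the denominator is a multiple of [k], which cancels against the factor [q]. *)
rewrite (_ : k + m * k * n = (m * n + 1) * k); last by ring.
rewrite mulnA [in RHS]mulnC => /eqP; rewrite eqn_pmul2r // => /eqP <-.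
rewrite GRing.natrM GRing.div1r GRing.mulrC GRing.mulfK //.
by rewrite Num.Theory.pnatr_eq0 addn1.
Qed.
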